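(* Let $\alpha=\alpha_0^{p^s}\in\mathcal{T}_2\setminus\{0\}$, where $\alpha_0\in\mathcal{T}_2$ is such that $x^n-\alpha_0$ is irreducible over $\mathcal{R}_2$. Let $\mathcal{C}$ be an $\alpha$-constacyclic code of length $np^s$ over $\mathcal{R}_2$. Then the RT distance $d_{RT}(\mathcal{C})$ is given by the following: (a) If $\mathcal{C}=\{0\}$, then $d_{RT}(\mathcal{C})=0$. (b) If $\mathcal{C}=\langle1\rangle$, then $d_{RT}(\mathcal{C})=1$. (c) If $\mathcal{C}=\langle\gamma(x^n-\alpha_0)^\tau\rangle$ is of Type II, then $d_{RT}(\mathcal{C})=n\tau+1$. (d) If $\mathcal{C}=\langle(x^n-\alpha_0)^\omega+\gamma(x^n-\alpha_0)^tG(x)\rangle$ is of Type III, then $d_{RT}(\mathcal{C})=n\kappa+1$. (e) If $\mathcal{C}=\langle(x^n-\alpha_0)^\omega+\gamma(x^n-\alpha_0)^tG(x),\gamma(x^n-\alpha_0)^\mu\rangle$ is of Type IV, then $d_{RT}(\mathcal{C})=n\mu+1$.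
   Context: $\mathcal{R}_2$ is a finite commutative chain ring with unity, with maximal ideal $\langle\gamma\rangle$, where $\gamma\neq0$ and $\gamma^2=0$; its residue field has order $p^m$, $p$ prime. $\zeta\in\mathcal{R}_2$ has multiplicative order $p^m-1$ and $\mathcal{T}_2=\{0,1,\zeta,\dots,\zeta^{p^m-2}\}$. $n,s$ are positive integers with $\gcd(n,p)=1$. $\alpha$-constacyclic codes of length $np^s$ over $\mathcal{R}_2$ are identified with ideals of $\mathcal{R}_{\alpha,0}=\mathcal{R}_2[x]/\langle x^{np^s}-\alpha\rangle$, whose elements are represented by polynomials of degree less than $np^s$. The Rosenbloom-Tsfasman (RT) weight is $w_{RT}(c(x))=1+\deg c(x)$ if $c(x)\neq0$ and $w_{RT}(0)=0$; $d_{RT}(\mathcal{C})=\min\{w_{RT}(c):c\in\mathcal{C}\setminus\{0\}\}$, with $d_{RT}(\{0\})=0$. Put $f(x)=x^n-\alpha_0$, and let $\mathcal{P}_n(\mathcal{T}_2)$ be the set of polynomials with coefficients in $\mathcal{T}_2$ that are $0$ or of degree less than $n$. The ideals of $\mathcal{R}_{\alpha,0}$ are: Type I: $\{0\}$, $\langle1\rangle$. Type II: $\langle\gamma f^\tau\rangle$, $0\le\tau<p^s$. Type III: $\langle f^\omega+\gamma f^tG\rangle$, where $0<\omega<p^s$, $0\le t<\kappa$ if $G\neq0$, and $G$ is $0$ or a unit of $\mathcal{R}_{\alpha,0}$ of the form $\sum_{i=0}^{\kappa-t-1}a_i(x)f(x)^i$ with $a_i\in\mathcal{P}_n(\mathcal{T}_2)$.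 Type IV: $\langle f^\omega+\gamma f^tG,\gamma f^\mu\rangle$, where $0\le\mu<\kappa\le\omega<p^s$, $0\le t<\mu$ if $G\neq0$, and $G$ is $0$ or a unit of $\mathcal{R}_{\alpha,0}$ of the form $\sum_{i=0}^{\mu-t-1}a_i(x)f(x)^i$ with $a_i\in\mathcal{P}_n(\mathcal{T}_2)$. In both types $\kappa$ is the smallest non-negative integer with $\gamma f^\kappa\in\langle f^\omega+\gamma f^tG\rangle$. *)

(* Defs.v *)
From HB Require Import structures.
From mathcomp Require Import all_boot all_order all_algebra.

Set Implicit Arguments.
Unset Strict Implicit.
Unset Printing Implicit Defensive.

Import GRing.Theory.
Local Open Scope ring_scope.

(* qpoly.v provides the finite structure and the ring structure of the quotient
   separately; this joins them. *)
HB.instance Definition _ (R : finComNzRingType) (h : {poly R}) :=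
  Finite.on {poly %/ h}.

(* GRing.unit is not available here: neither {poly R} nor {poly %/ h} has a
   canonical unitRingType structure when R is not a domain. *)
Definition invertible (A : comNzRingType) (x : A) : Prop :=
  exists y : A, x * y = 1.

Definition irreducible_elt (A : comNzRingType) (x : A) : Prop :=
  [/\ x <> 0, ~ invertible x &
      forall y z : A, x = y * z -> invertible y \/ invertible z].

(* Unlike idealr_closed in ring_quotient.v, the whole ring is allowed. *)
Definition is_ideal (A : finComNzRingType) (I : {set A}) : Prop :=
  [/\ 0 \in I, {in I &, forall x y, x + y \in I} &
      forall a x : A, x \in I -> a * x \in I].

Definition ideal1 (A : finComNzRingType) (g : A) : {set A} :=
  [set a * g | a : A].

Definition ideal2 (A : finComNzRingType) (g1 g2 : A) : {set A} :=
  [set a * g1 + b * g2 | a : A, b : A].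

Definition is_maximal_ideal (A : finComNzRingType) (M : {set A}) : Prop :=
  [/\ is_ideal M, M <> setT &
      forall I : {set A}, is_ideal I -> M \subset I -> I = M \/ I = setT].

Definition is_chain_ring (A : finComNzRingType) : Prop :=
  forall I J : {set A}, is_ideal I -> is_ideal J -> I \subset J \/ J \subset I.

Definition residue_ring (A : finComNzRingType) (I : {set A}) : {set {set A}} :=
  [set [set a + x | x in I] | a : A].

Definition teichmuller (R : finComNzRingType) (zeta : R) (q : nat) : {set R} :=
  0 |: [set zeta ^+ i | i : 'I_q.-1].

Definition Pn (R : finComNzRingType) (n : nat) (T : {set R}) (a : {poly R}) :
    bool :=
  (size a <= n)%N && (a \is a polyOver T).

Definition constacyclic_modulus (R : finComNzRingType) (N : nat) (alpha : R) :
    {poly R} :=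
  'X^N - alpha%:P.

(* size c is 1 + deg c if c <> 0, and size 0 is 0. *)
Definition rt_weight (R : finComNzRingType) (h : {poly R}) (c : {poly %/ h}) :
    nat :=
  size (c : {poly R}).

Definition rt_distance (R : finComNzRingType) (h : {poly R})
    (C : {set {poly %/ h}}) : nat :=
  if [pick c in C :\ 0] is Some c0
  then rt_weight [arg min_(c < c0 in C :\ 0) rt_weight c]
  else 0%N.

Definition is_kappa (R : finComNzRingType) (h : {poly R}) (gamma : R)
    (f : {poly %/ h}) (I : {set {poly %/ h}}) (kappa : nat) : Prop :=
  gamma *: f ^+ kappa \in I /\
  forall k : nat, gamma *: f ^+ k \in I -> (kappa <= k)%N.

Definition zero_or_unit_form (R : finComNzRingType) (h : {poly R}) (n : nat)
    (T : {set R}) (f : {poly %/ h}) (k : nat) (G : {poly %/ h}) : Prop :=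
  G = 0 \/
  invertible G /\
  exists a : nat -> {poly R},
    (forall i : nat, (i < k)%N -> Pn n T (a i)) /\
    G = \sum_(i < k) in_qpoly h (a i) * f ^+ i.

Definition type3_data (R : finComNzRingType) (h : {poly R}) (gamma : R)
    (n q : nat) (T : {set R}) (f : {poly %/ h}) (omega t : nat)
    (G : {poly %/ h}) (kappa : nat) : Prop :=
  [/\ (0 < omega < q)%N,
      is_kappa gamma f (ideal1 (f ^+ omega + gamma *: (f ^+ t * G))) kappa,
      (G <> 0 -> (t < kappa)%N) &
      zero_or_unit_form n T f (kappa - t) G].

Definition type4_data (R : finComNzRingType) (h : {poly R}) (gamma : R)
    (n q : nat) (T : {set R}) (f : {poly %/ h}) (omega t : nat)
    (G : {poly %/ h}) (kappa mu : nat) : Prop :=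
  [/\ [&& (mu < kappa)%N, (kappa <= omega)%N & (omega < q)%N],
      is_kappa gamma f (ideal1 (f ^+ omega + gamma *: (f ^+ t * G))) kappa,
      (G <> 0 -> (t < mu)%N) &
      zero_or_unit_form n T f (mu - t) G].

(* Main.v *)
Require Import Defs.
From HB Require Import structures.
From mathcomp Require Import all_boot all_order all_algebra all_field.
From mathcomp Require Import ring.

Set Implicit Arguments.
Unset Strict Implicit.
Unset Printing Implicit Defensive.

Import GRing.Theory.
Local Open Scope ring_scope.

(** Every nonzero code has distance [n * kappa + 1], where [kappa] is the least
    exponent with [gamma f^kappa] in the code; the five cases only differ in the
    computation of [kappa].

    Write [F] for the residue field and [phi] for the image of [x^n - alpha0] in
    [F[x]].  In characteristic [p] the modulus [x^(n p^s) - alpha] reduces to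
    [phi^(p^s)].  Since [gamma x] depends only on the residue of [x], and
    vanishes only if that residue does, the word [gamma b] has the same weight
    as the reduction of [b].  A nonzero word [c] of the code is either such a
    [gamma b], or has nonzero reduction, and then [gamma c] is a nonzero word of
    the code that weighs at most as much as [c].  So the distance is attained on
    words [gamma b], hence is the least size of a nonzero element of the torsion
    code, the ideal of [F[x] / phi^(p^s)] formed by the reductions of these [b].
    This ideal is generated by a divisor of [phi^(p^s)], which is a power of
    [phi] because [phi] is irreducible: it is [phi^kappa] by minimality of
    [kappa] ([torsion_dvdp], [rt_distance_kappa]).

    The hypothesis gives the irreducibility of [x^n - alpha0] over the chain
    ring only; it descends to [F] ([irreducible_rho]) by one step of Hensel
    lifting: [phi] is separable, as [p] does not divide [n], so a factorization
    of [phi] has coprime factors, and it lifts exactly because [gamma^2 = 0].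

    As for [kappa]: it is [0] for the unit ideal, [tau] for
    [gamma f^tau] ([is_kappa_gamma]), at most [omega] in the presence of a
    generator [f^omega + gamma b] ([is_kappa_le]), and adjoining [gamma f^mu]
    with [mu <= kappa] lowers it to [mu] ([is_kappa_join]). *)

(** * Ideals with one or two generators *)

Section Ideals.
Context (A : finComNzRingType).
Implicit Types (g x : A).

Lemma mem_ideal1 g x : x \in ideal1 g <-> exists a, x = a * g.
Proof. by split=> [/imsetP[a _ ->]|[a ->]]; [exists a | apply: imset_f]. Qed.

Lemma mem_ideal2 g1 g2 x :
  x \in ideal2 g1 g2 <-> exists a b, x = a * g1 + b * g2.
Proof.
split=> [/imset2P[a b _ _ ->]|[a [b ->]]]; first by exists a, b.
exact: imset2_f.
Qed.

Lemma ideal1_is_ideal g : is_ideal (ideal1 g).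
Proof.
split=> [|x y|a x].
- by apply/mem_ideal1; exists 0; rewrite mul0r.
- move=> /mem_ideal1[a ->] /mem_ideal1[b ->]; apply/mem_ideal1.
  by exists (a + b); rewrite mulrDl.
- by move=> /mem_ideal1[b ->]; apply/mem_ideal1; exists (a * b); rewrite mulrA.
Qed.

Lemma ideal2_is_ideal g1 g2 : is_ideal (ideal2 g1 g2).
Proof.
split=> [|x y|a x].
- by apply/mem_ideal2; exists 0, 0; rewrite !mul0r addr0.
- move=> /mem_ideal2[a [b ->]] /mem_ideal2[c [d ->]]; apply/mem_ideal2.
  by exists (a + c), (b + d); rewrite !mulrDl addrACA.
- move=> /mem_ideal2[c [d ->]]; apply/mem_ideal2.
  by exists (a * c), (a * d); rewrite mulrDr !mulrA.
Qed.

End Ideals.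

(** * The residue field of a maximal ideal *)

Section ResidueField.
Local Open Scope quotient_scope.
Context (A : finComNzRingType) (g : A).
Hypothesis maxg : is_maximal_ideal (ideal1 g).

(** The proof of maximality is an argument so that the ideal structure declared
    below, which depends on it, can be inferred from the predicate. *)
Definition max_ideal of is_maximal_ideal (ideal1 g) : {pred A} :=
  fun x => x \in ideal1 g.

Lemma max_idealP : idealr_closed (max_ideal maxg).
Proof.
have [[I0 ID IM] properI _] := maxg; split=> //.
- apply/negP=> I1; apply: properI; apply/setP=> x.
  by rewrite inE -[x]mulr1 IM.
- by move=> a x y Ix Iy; apply: ID => //; apply: IM.
Qed.

HB.instance Definition _ := isIdealr.Build A (max_ideal maxg) max_idealP.

Definition residue_field : predArgType :=
  {ideal_quot (max_ideal maxg : idealr A)}.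

HB.instance Definition _ := GRing.ComNzRing.on residue_field.

Definition residue (x : A) : residue_field :=
  \pi_{ideal_quot (max_ideal maxg : idealr A)} x.

HB.instance Definition _ := GRing.RMorphism.copy residue
  \pi_{ideal_quot (max_ideal maxg : idealr A)}.

Lemma residue_surj y : exists x, residue x = y.
Proof. by exists (repr y); rewrite /residue reprK. Qed.

Lemma residue_eq x y : (residue x == residue y) = (x - y \in ideal1 g).
Proof.
have := Quotient.idealrBE (max_ideal maxg : idealr A) x y.
by rewrite /residue => <-.
Qed.

Lemma residue_eq0 x : residue x = 0 <-> exists y, x = y * g.
Proof.
apply: iff_trans (mem_ideal1 g x).
by rewrite -{2}(subr0 x) -residue_eq rmorph0; split=> /eqP.
Qed.

Definition residue_inv (y : residue_field) : residue_field :=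
  if [pick x | residue x * y == 1] is Some x then residue x else 0.

(** The ideal generated by [g] and a lift of [y] strictly contains the maximal
    ideal, so it contains 1; reducing this combination inverts [y]. *)
Lemma residue_mulVf y : y != 0 -> residue_inv y * y = 1.
Proof.
rewrite /residue_inv; case: pickP => [x /eqP//|no_inv y_neq0].
have [x xy] := residue_surj y; have [_ _ maxI] := maxg.
have [|ideal2_eq|ideal2_eq] := maxI _ (ideal2_is_ideal x g).
- apply/subsetP=> z /mem_ideal1[a ->]; apply/mem_ideal2.
  by exists 0, a; rewrite mul0r add0r.
- case/negP: y_neq0; rewrite -xy -[0](rmorph0 residue) residue_eq subr0.
  rewrite -ideal2_eq; apply/mem_ideal2; exists 1, 0.
  by rewrite mul1r mul0r addr0.
have: 1 \in ideal2 x g by rewrite ideal2_eq inE.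
case/mem_ideal2=> a [b eq1]; have := no_inv a.
rewrite -xy -rmorphM -[1 in X in X = _](rmorph1 residue) residue_eq eq1.
rewrite opprD addNKr => /negP[]; apply/mem_ideal1; exists (- b).
by rewrite mulNr.
Qed.

Lemma residue_inv0 : residue_inv 0 = 0.
Proof.
rewrite /residue_inv; case: pickP => [x|//].
by rewrite mulr0 eq_sym oner_eq0.
Qed.

HB.instance Definition _ := GRing.ComNzRing_isField.Build residue_field
  residue_mulVf residue_inv0.

HB.instance Definition _ :=
  isCountable.Build residue_field (pcan_pickleK (can_pcan
    (@reprK _ {ideal_quot (max_ideal maxg : idealr A)}))).

HB.instance Definition _ : isFinite residue_field :=
  CanIsFinite (@reprK _ {ideal_quot (max_ideal maxg : idealr A)}).

(** Each residue class corresponds to the coset of its representative. *)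
Lemma card_residue_field : #|residue_field| = #|residue_ring (ideal1 g)|.
Proof.
pose coset (y : residue_field) := [set repr y + x | x in ideal1 g].
have mem_coset x y : (x \in coset y) = (residue x == y).
  rewrite -[in RHS](reprK y) -/(residue (repr y)) residue_eq.
  apply/imsetP/idP => [[z Iz ->]|Ixy]; first by rewrite addrAC subrr add0r.
  by exists (x - repr y); rewrite // addrC subrK.
have coset_inj : injective coset.
  move=> y z /setP/(_ (repr y)); rewrite !mem_coset {1 2}/residue reprK eqxx.
  by move/esym/eqP.
rewrite -(card_imset _ coset_inj); apply: eq_card => I.
apply/imsetP/imsetP => [[y _ ->]|[a _ ->]]; first by exists (repr y).
exists (residue a) => //; apply/setP=> x; rewrite mem_coset residue_eq.
apply/imsetP/idP => [[z Iz ->]|Ixa]; first by rewrite addrAC subrr add0r.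
by exists (x - a); rewrite // addrC subrK.
Qed.

End ResidueField.

(** * Polynomials over a field *)

Section FieldPolynomials.
Context (F : fieldType).
Implicit Types (phi d : {poly F}).

(** The derivative is a nonzero multiple of [x^(n-1)], which is coprime to a
    polynomial with nonzero constant term. *)
Lemma separable_Xn_sub_C n (a : F) :
  n%:R != 0 :> F -> a != 0 -> separable_poly ('X^n - a%:P).
Proof.
case: n => [/eqP//|n] n_neq0 a_neq0.
rewrite unlock derivB derivC subr0 derivXn -scaler_nat coprimepZr //= exprS.
rewrite -polyCN coprimep_sym coprimep_addl_mul -[_%:P]alg_polyC coprimepZr.
  exact: coprimep1.
by rewrite oppr_eq0.
Qed.

(** Peel off the last factor of [phi^q]: it divides [d] or is coprime to [d]. *)
Lemma irreducible_dvdp_exp phi q d :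
  irreducible_poly phi -> d %| phi ^+ q -> exists j, d %= phi ^+ j.
Proof.
move=> irr_phi; elim: q d => [|q IHq] d.
  by rewrite expr0 dvdp1 size_poly_eq1; exists 0%N.
have [phi_d|phi_nd] := boolP (phi %| d).
  have [c ->] := dvdpP _ _ phi_d.
  rewrite exprSr dvdp_mul2r ?irredp_neq0 // => /IHq[j eq_cj].
  by exists j.+1; rewrite exprSr eqp_mulr.
rewrite exprSr Gauss_dvdpl; last first.
  by rewrite coprimep_sym irreducible_poly_coprime.
exact: IHq.
Qed.

End FieldPolynomials.

(** * Reduction of polynomials modulo gamma *)

Lemma eq_size_poly (A B : nzSemiRingType) (p : {poly A}) (q : {poly B}) :
  (forall i, (p`_i == 0) = (q`_i == 0)) -> size p = size q.
Proof.
move=> eq_pq; apply/eqP; rewrite eqn_leq; apply/andP; split.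
  by apply/leq_sizeP=> i /leq_sizeP/(_ _ (leqnn i))/eqP; rewrite -eq_pq => /eqP.
by apply/leq_sizeP=> i /leq_sizeP/(_ _ (leqnn i))/eqP; rewrite eq_pq => /eqP.
Qed.

Section Reduction.
Context (A : finComNzRingType) (F : fieldType) (red : {rmorphism A -> F}).
Context (gamma : A).
Hypothesis red_surj : forall y, exists x, red x = y.
Hypothesis red_eq0 : forall x, red x = 0 <-> exists y, x = y * gamma.
Hypothesis gamma_neq0 : gamma <> 0.
Hypothesis gamma_sq0 : gamma ^+ 2 = 0.

Notation rho := (map_poly red).
Implicit Types (x y : A) (p q g : {poly A}) (P Q : {poly F}).

(** The annihilator of [gamma] is exactly the maximal ideal: an element outside
    it is invertible modulo [gamma], and [gamma] is killed by [gamma]. *)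
Lemma mulgamma_eq0 x : (gamma * x == 0) = (red x == 0).
Proof.
apply/eqP/eqP=> [gx0|/red_eq0[y ->]]; last first.
  by rewrite mulrCA -expr2 gamma_sq0 mulr0.
apply/eqP; apply: contra_notT gamma_neq0 => x_neq0.
have [y redy] := red_surj (red x)^-1.
have [z xy1] : exists z, x * y - 1 = z * gamma.
  by apply/red_eq0; rewrite rmorphB rmorphM rmorph1 redy divff ?subrr.
have: gamma * (x * y - 1) = 0 by rewrite xy1 mulrCA -expr2 gamma_sq0 mulr0.
by rewrite mulrBr mulr1 mulrA gx0 mul0r sub0r => /eqP; rewrite oppr_eq0 => /eqP.
Qed.

Lemma rho_gamma : rho gamma%:P = 0.
Proof.
rewrite map_polyC /= (_ : red gamma = 0) ?polyC0 //.
by apply/red_eq0; exists 1; rewrite mul1r.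
Qed.

(** Multiplication by [gamma] transfers the weight of a word [gamma p] to
    polynomials over the residue field. *)
Lemma size_scale_gamma p : size (gamma *: p) = size (rho p).
Proof.
apply: eq_size_poly => i.
by rewrite coefZ coef_map_id0 ?rmorph0 // mulgamma_eq0.
Qed.

Lemma scale_gamma_eq p q : gamma *: p = gamma *: q <-> rho p = rho q.
Proof.
have: (gamma *: (p - q) == 0) = (rho (p - q) == 0).
  by rewrite -!size_poly_eq0 size_scale_gamma.
rewrite scalerBr rmorphB /= !subr_eq0 => eq_pq.
by split=> /eqP; [rewrite eq_pq | rewrite -eq_pq] => /eqP.
Qed.

Lemma rho_surj P : exists p, rho p = P.
Proof.
elim/poly_ind: P => [|P c [p <-]]; first by exists 0; rewrite rmorph0.
have [a <-] := red_surj c; exists (p * 'X + a%:P).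
by rewrite rmorphD rmorphM /= map_polyX map_polyC.
Qed.

Lemma rho_eq0 p : rho p = 0 -> exists q, p = gamma%:P * q.
Proof.
move=> rhop0.
(* [quo] divides by [gamma], which determines its value only modulo [gamma]. *)
pose quo a := odflt 0 [pick y | a == y * gamma].
exists (\poly_(i < size p) quo p`_i); apply/polyP=> i; rewrite coefCM coef_poly.
case: ltnP => [_|/leq_sizeP->//]; last by rewrite mulr0.
have [y pi_y] : exists y, p`_i = y * gamma.
  by apply/red_eq0; rewrite -coef_map rhop0 coef0.
rewrite /quo; case: pickP => [z /eqP-> /=|/(_ y)/eqP//]; exact: mulrC.
Qed.

Lemma invertible_size_rho p : invertible p -> size (rho p) = 1%N.
Proof.
case=> q /(congr1 rho); rewrite rmorphM rmorph1 => pq1.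
by apply/eqP; rewrite -dvdp1 -pq1 dvdp_mulr.
Qed.

(** One step of Hensel lifting. If [rho g] is the product of [P] and [Q], with
    lifts [p0] and [q0], then [g = p0 q0 + gamma e]; separability provides
    [u p0 + v q0 = 1] modulo [gamma], and then
    [g = (p0 + gamma e v) (q0 + gamma e u)] holds exactly since [gamma^2 = 0].
    The lifted factors may have larger degree than [P] and [Q], but a unit of
    [A[x]] reduces to a constant, so neither of them is a unit unless [P] or [Q]
    is constant. *)
Lemma irreducible_rho g :
  g \is monic -> separable_poly (rho g) -> irreducible_elt g ->
  irreducible_poly (rho g).
Proof.
move=> monic_g sep_g [g_neq0 g_ninv irr_g]; split.
  rewrite size_map_poly_id0 ?(monicP monic_g) ?rmorph1 ?oner_eq0 //.
  rewrite ltnNge; apply/negP=> /size1_polyC def_g; apply: g_ninv; exists 1.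
  rewrite mulr1 def_g; congr _%:P.
  by have := monicP monic_g; rewrite {1}def_g lead_coefC.
move=> Q Q_n1 /dvdpP[P rho_g].
move: sep_g; rewrite rho_g separable_mul => /and3P[_ _].
case/Bezout_eq1_coprimepP=> -[U V] /= bezPQ.
have [p0 rho_p] := rho_surj P; have [q0 rho_q] := rho_surj Q.
have [u rho_u] := rho_surj U; have [v rho_v] := rho_surj V.
have [e def_g] : exists e, g - p0 * q0 = gamma%:P * e.
  by apply: rho_eq0; rewrite rmorphB rmorphM /= rho_p rho_q rho_g subrr.
have [w def_1] : exists w, u * p0 + v * q0 - 1 = gamma%:P * w.
  apply: rho_eq0; rewrite rmorphB rmorphD !rmorphM rmorph1 /=.
  by rewrite rho_u rho_v rho_p rho_q bezPQ subrr.
have gamma2 : gamma%:P * gamma%:P = 0 :> {poly A}.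
  by rewrite -polyCM -expr2 gamma_sq0.
have rho_lift p r : rho (p + gamma%:P * r) = rho p.
  by rewrite rmorphD rmorphM /= rho_gamma mul0r addr0.
have: g = (p0 + gamma%:P * (e * v)) * (q0 + gamma%:P * (e * u)).
  transitivity (p0 * q0 + gamma%:P * e
     + gamma%:P * gamma%:P * (e * w + e * e * u * v)).
    by rewrite gamma2 mul0r addr0 -def_g addrC subrK.
  have -> : gamma%:P * gamma%:P * (e * w + e * e * u * v)
     = e * gamma%:P * (gamma%:P * w) + gamma%:P * gamma%:P * (e * e * u * v).
    by ring.
  by rewrite -def_1; ring.
case/irr_g=> /invertible_size_rho; rewrite rho_lift ?rho_p ?rho_q => size1.
  rewrite -{1}[Q]mul1r eqp_mulr // eqp_sym.
  by rewrite -size_poly_eq1 size1.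
by rewrite size1 in Q_n1.
Qed.

End Reduction.

(** * The distance and the torsion exponent of a code *)

Lemma rt_distance_eq (A : finComNzRingType) (h : {poly A})
    (C : {set {poly %/ h}}) c0 w :
  c0 \in C -> c0 != 0 -> rt_weight c0 = w ->
  (forall c, c \in C -> c != 0 -> (w <= rt_weight c)%N) ->
  rt_distance C = w.
Proof.
move=> Cc0 c0_neq0 <- min_c0; rewrite /rt_distance.
case: pickP => [c1 Cc1|/(_ c0)]; last by rewrite !inE c0_neq0 Cc0.
case: arg_minnP => // c; rewrite !inE => /andP[c_neq0 Cc] min_c.
apply/eqP; rewrite eqn_leq min_c0 // andbT.
by apply: min_c; rewrite !inE c0_neq0.
Qed.

(** The roles of [x^n - alpha0] and of its modulus are played by a monic [g] with
    irreducible reduction [phi], and by a monic [h] that reduces to a power of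
    [phi]. *)
Section Torsion.
Context (A : finComNzRingType) (F : fieldType) (red : {rmorphism A -> F}).
Context (gamma : A).
Hypothesis red_surj : forall y, exists x, red x = y.
Hypothesis red_eq0 : forall x, red x = 0 <-> exists y, x = y * gamma.
Hypothesis gamma_neq0 : gamma <> 0.
Hypothesis gamma_sq0 : gamma ^+ 2 = 0.
Context (g h : {poly A}) (q : nat).
Notation rho := (map_poly red).
Hypothesis monic_g : g \is monic.
Hypothesis monic_h : h \is monic.
Hypothesis rho_h : rho h = rho g ^+ q.
Hypothesis q_gt0 : (0 < q)%N.
Hypothesis irr_g : irreducible_poly (rho g).

Notation phi := (rho g).
Notation f := (in_qpoly h g).
Implicit Types (c b : {poly %/ h}) (I : {set {poly %/ h}}).

Let size_rho_monic (p : {poly A}) : p \is monic -> size (rho p) = size p.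
Proof.
by move=> /monicP p1; rewrite size_map_poly_id0 // p1 rmorph1 oner_eq0.
Qed.

Let size_rho_le (p : {poly A}) : (size (rho p) <= size p)%N.
Proof. exact: size_poly. Qed.

Let phi_neq0 : phi != 0 := irredp_neq0 irr_g.

Lemma size_modulus : size h = (q * (size g).-1).+1.
Proof.
rewrite -(size_rho_monic monic_h) -(size_rho_monic monic_g) rho_h mulnC.
by rewrite -size_exp prednK // size_poly_gt0 expf_neq0.
Qed.

Let g_gt1 : (1 < size g)%N.
Proof. by rewrite -(size_rho_monic monic_g) irr_g.1. Qed.

Lemma mk_monic_modulus : mk_monic h = h.
Proof.
rewrite /mk_monic monic_h size_modulus ltnS muln_gt0 q_gt0 /=.
by rewrite -ltnS prednK ?g_gt1 // ltnW.
Qed.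

(** Euclidean division by the monic [h] commutes with reduction, so [rho] passes
    to the quotients by [h] and by [rho h = phi^q]. *)
Lemma rho_in_qpoly p : rho (in_qpoly h p) = rho p %% rho h.
Proof.
rewrite /= mk_monic_modulus; set r := Pdiv.CommonRing.rmodp p h.
apply: (@modpP _ _ (rho (Pdiv.CommonRing.rdivp p h))).
  by rewrite -rmorphM -rmorphD /= -Pdiv.RingMonic.rdivp_eq.
rewrite (size_rho_monic monic_h); apply: leq_ltn_trans (size_rho_le _) _.
by rewrite Pdiv.Ring.ltn_rmodpN0 // monic_neq0.
Qed.

Lemma in_qpolyK c : in_qpoly h c = c.
Proof.
by apply: val_inj; rewrite /= Pdiv.CommonRing.rmodp_small ?size_mk_monic.
Qed.

Lemma rho_qpolyD b c : rho (b + c) = rho b + rho c.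
Proof. exact: (rmorphD rho). Qed.

Lemma rho_qpolyM b c : rho (b * c) = (rho b * rho c) %% rho h.
Proof.
rewrite -rmorphM -rho_in_qpoly; congr rho; congr val; exact: val_inj.
Qed.

Lemma rho_f_exp j : rho (f ^+ j) = phi ^+ j %% rho h.
Proof. by rewrite -rmorphXn rho_in_qpoly rmorphXn. Qed.

Lemma gamma_qpoly_eq b c : gamma *: b = gamma *: c <-> rho b = rho c.
Proof.
rewrite -(scale_gamma_eq red_surj) //.
by split=> [/(congr1 val)//|eq_bc]; apply: val_inj.
Qed.

(** The gcd of [rho b] and [phi^q] is some [phi^j], and a Bezout relation turns
    [gamma b] into [gamma f^j], so that [kappa <= j]. *)
Lemma torsion_dvdp I kappa b :
  is_ideal I -> is_kappa gamma f I kappa -> gamma *: b \in I ->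
  phi ^+ kappa %| rho b.
Proof.
move=> [_ _ IM] [_ kappa_min] Ib.
have [j gcd_eq] :=
  irreducible_dvdp_exp irr_g (dvdp_gcdr (rho b) (phi ^+ q)).
have [[U V] /= bez] := Bezoutp (rho b) (phi ^+ q).
have /eqpf_eq[a a_neq0 def_phij] : phi ^+ j %= U * rho b + V * phi ^+ q.
  by rewrite eqp_sym (eqp_trans bez).
have [u rho_u] := rho_surj red_surj (a *: U).
have le_kappa : (kappa <= j)%N.
  apply: kappa_min.
  suff -> : gamma *: f ^+ j = in_qpoly h u * (gamma *: b) by exact: IM.
  rewrite -scalerAr; apply/gamma_qpoly_eq.
  rewrite rho_f_exp rho_qpolyM rho_in_qpoly rho_u rho_h.
  rewrite mulrC modp_mul mulrC def_phij scalerDr modpD.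
  by rewrite !scalerAl modp_mull addr0.
apply: dvdp_trans (dvdp_exp2l _ le_kappa) _.
by rewrite -(eqp_dvdl _ gcd_eq) dvdp_gcdl.
Qed.

Lemma rho_f_exp_small k : (k < q)%N -> rho (f ^+ k) = phi ^+ k.
Proof.
move=> lt_kq; rewrite rho_f_exp rho_h modp_small //.
rewrite -(@prednK (size (phi ^+ k))) ?size_poly_gt0 ?expf_neq0 //.
rewrite -(@prednK (size (phi ^+ q))) ?size_poly_gt0 ?expf_neq0 //.
rewrite !size_exp ltnS ltn_pmul2l //.
by rewrite -ltnS prednK ?size_rho_monic ?g_gt1 // ltnW.
Qed.

Lemma dvdp_phi_exp k d : (k < q)%N -> phi ^+ d %| rho (f ^+ k) -> (d <= k)%N.
Proof.
move=> lt_kq; rewrite rho_f_exp_small //.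
by rewrite dvdp_Pexp2l // size_rho_monic.
Qed.

(** The minimum is attained at [gamma f^kappa]. A word [c] with nonzero
    reduction is compared with the word [gamma c]. *)
Theorem rt_distance_kappa I kappa :
  is_ideal I -> is_kappa gamma f I kappa -> (kappa < q)%N ->
  rt_distance I = (kappa * (size g).-1 + 1)%N.
Proof.
move=> idealI kappaI lt_kq; have [_ _ IM] := idealI.
have wt_gamma b : rt_weight (gamma *: b) = size (rho b).
  exact: (size_scale_gamma red_surj).
have size_phi : size (phi ^+ kappa) = (kappa * (size g).-1 + 1)%N.
  rewrite addn1 -(size_rho_monic monic_g) mulnC -size_exp prednK //.
  by rewrite size_poly_gt0 expf_neq0.
have dvd_size b : gamma *: b \in I -> rho b != 0 ->
    (kappa * (size g).-1 + 1 <= size (rho b))%N.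
  by move=> Ib b_neq0; rewrite -size_phi dvdp_leq // (torsion_dvdp idealI).
have wt_f : rt_weight (gamma *: f ^+ kappa) = (kappa * (size g).-1 + 1)%N.
  by rewrite wt_gamma rho_f_exp_small.
apply: (rt_distance_eq kappaI.1 _ wt_f) => [|c Ic c_neq0].
  apply: contra_eq_neq wt_f => ->; by rewrite addn1 /rt_weight /= size_poly0.
have [rho_c0|rho_c_neq0] := eqVneq (rho c) 0.
  have [p def_c] := rho_eq0 red_eq0 rho_c0.
  have def_c' : c = gamma *: in_qpoly h p.
    by rewrite -in_qpolyZ -mul_polyC -def_c in_qpolyK.
  rewrite def_c' wt_gamma dvd_size -?def_c' //; apply: contra_neq c_neq0.
  move=> rho0; rewrite def_c' -[RHS](scaler0 _ gamma).
  by apply/gamma_qpoly_eq; rewrite rho0 rmorph0.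
apply: leq_trans (dvd_size c _ rho_c_neq0) (size_rho_le _).
by rewrite -[c]mul1r scalerAl IM.
Qed.

Lemma dvdp_rhoM_f d b : (d < q)%N -> phi ^+ d %| rho (b * f ^+ d).
Proof.
move=> lt_dq; rewrite rho_qpolyM rho_h -dvdp_mod ?dvdp_exp2l 1?ltnW //.
by rewrite rho_f_exp_small // dvdp_mull.
Qed.

Lemma is_kappa_unit : is_kappa gamma f (ideal1 1) 0.
Proof.
by split=> //; apply/mem_ideal1; exists (gamma *: f ^+ 0); rewrite mulr1.
Qed.

Lemma is_kappa_gamma tau :
  (tau < q)%N -> is_kappa gamma f (ideal1 (gamma *: f ^+ tau)) tau.
Proof.
move=> lt_tau; split=> [|k /mem_ideal1[a]].
  by apply/mem_ideal1; exists 1; rewrite mul1r.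
rewrite -scalerAr => /gamma_qpoly_eq rho_fk.
rewrite leqNgt; apply/negP=> lt_k.
suff: (tau <= k)%N by rewrite leqNgt lt_k.
by apply: dvdp_phi_exp; rewrite ?(ltn_trans lt_k) // rho_fk dvdp_rhoM_f.
Qed.

(** [gamma^2 = 0] gives [gamma (f^omega + gamma b) = gamma f^omega]. *)
Lemma is_kappa_le omega kappa b :
  is_kappa gamma f (ideal1 (f ^+ omega + gamma *: b)) kappa ->
  (kappa <= omega)%N.
Proof.
case=> _; apply; apply/mem_ideal1; exists gamma%:A.
by rewrite -scalerAl mul1r scalerDr scalerA -expr2 gamma_sq0 scale0r addr0.
Qed.

(** If [gamma f^k = a r + b gamma f^mu], then [gamma (f^k - b f^mu)] lies in the
    ideal of [r], so [phi^kappa], a fortiori [phi^mu], divides the reduction of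
    [f^k - b f^mu], and hence that of [f^k]. *)
Lemma is_kappa_join r kappa mu :
  is_kappa gamma f (ideal1 r) kappa -> (mu <= kappa)%N -> (mu < q)%N ->
  is_kappa gamma f (ideal2 r (gamma *: f ^+ mu)) mu.
Proof.
move=> kappar le_mu lt_mu; split=> [|k /mem_ideal2[a [b def_fk]]].
  by apply/mem_ideal2; exists 0, 1; rewrite mul0r mul1r add0r.
rewrite leqNgt; apply/negP=> lt_k.
suff: (mu <= k)%N by rewrite leqNgt lt_k.
apply: dvdp_phi_exp; first exact: ltn_trans lt_mu.
rewrite -[f ^+ k](subrK (b * f ^+ mu)) rho_qpolyD dvdp_add ?dvdp_rhoM_f //.
apply: dvdp_trans (dvdp_exp2l _ le_mu) _.
apply: (torsion_dvdp (ideal1_is_ideal r) kappar).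
by apply/mem_ideal1; exists a; rewrite scalerBr def_fk scalerAr addrK.
Qed.

End Torsion.

(** * The Rosenbloom-Tsfasman distances *)

Theorem theorem3p9 (R : finComNzRingType) (gamma zeta alpha0 alpha : R)
    (p m n s : nat)
    (C : {set {poly %/ constacyclic_modulus (n * p ^ s) alpha}}) :
  let T := teichmuller zeta (p ^ m) in
  let h := constacyclic_modulus (n * p ^ s) alpha in
  let f : {poly %/ h} := in_qpoly h ('X^n - alpha0%:P) in
  is_chain_ring R ->
  is_maximal_ideal (ideal1 gamma) ->
  gamma <> 0 ->
  gamma ^+ 2 = 0 ->
  prime p ->
  #|residue_ring (ideal1 gamma)| = (p ^ m)%N ->
  (p ^ m).-1.-primitive_root zeta ->
  (0 < n)%N ->
  (0 < s)%N ->
  coprime n p ->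
  alpha0 \in T ->
  alpha = alpha0 ^+ (p ^ s) ->
  alpha \in T :\ 0 ->
  irreducible_elt ('X^n - alpha0%:P : {poly R}) ->
  is_ideal C ->
  [/\ C = [set 0] -> rt_distance C = 0%N,
      C = ideal1 1 -> rt_distance C = 1%N,
      forall tau : nat, (tau < p ^ s)%N ->
        C = ideal1 (gamma *: f ^+ tau) ->
        rt_distance C = (n * tau + 1)%N,
      forall (omega t kappa : nat) (G : {poly %/ h}),
        type3_data gamma n (p ^ s) T f omega t G kappa ->
        C = ideal1 (f ^+ omega + gamma *: (f ^+ t * G)) ->
        rt_distance C = (n * kappa + 1)%N
    & forall (omega t kappa mu : nat) (G : {poly %/ h}),
        type4_data gamma n (p ^ s) T f omega t G kappa mu ->
        C = ideal2 (f ^+ omega + gamma *: (f ^+ t * G)) (gamma *: f ^+ mu) ->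
        rt_distance C = (n * mu + 1)%N].
Proof.
move=> T h f _ max_gamma gamma_neq0 gamma_sq0 p_pr card_res prim_zeta n_gt0 _.
move=> co_np alpha0T def_alpha /setD1P[alpha_neq0 _] irr_g idealC.
pose F : finFieldType := residue_field max_gamma.
pose red : {rmorphism R -> F} := residue max_gamma.
have red_surj : forall y, exists x, red x = y := @residue_surj _ _ max_gamma.
have red_eq0 : forall x, red x = 0 <-> exists y, x = y * gamma :=
  @residue_eq0 _ _ max_gamma.
have q_gt0 : (0 < p ^ s)%N by rewrite expn_gt0 prime_gt0.
have pcharF : p \in [pchar F].
  apply: (@card_finPcharP F p m) => //.
  by rewrite -card_res -card_residue_field.
have n_neq0 : n%:R != 0 :> F.
  by rewrite -(dvdn_pcharf pcharF) -prime_coprime // coprime_sym.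
have red_alpha0 : red alpha0 != 0.
  move: alpha0T; rewrite !inE => /orP[/eqP alpha00|/imsetP[i _ ->]].
    by rewrite def_alpha alpha00 expr0n gtn_eqF // eqxx in alpha_neq0.
  rewrite rmorphXn expf_neq0 //; apply/eqP=> zeta0.
  have /(congr1 red)/eqP := prim_expr_order prim_zeta.
  rewrite rmorphXn zeta0 rmorph1 expr0n gtn_eqF ?(prim_order_gt0 prim_zeta) //.
  by rewrite eq_sym oner_eq0.
set g := 'X^n - alpha0%:P in irr_g f *.
have rho_g : map_poly red g = 'X^n - (red alpha0)%:P.
  by rewrite rmorphB /= map_polyXn map_polyC.
have monic_g : g \is monic by rewrite monicXnsubC.
have monic_h : h \is monic by rewrite monicXnsubC // muln_gt0 n_gt0.
have size_g : (size g).-1 = n by rewrite size_XnsubC.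
(* Iterated Frobenius over the residue field:
   [phi^(p^s) = x^(n p^s) - alpha]. *)
have pchar_q : [pchar {poly F}].-nat (p ^ s)%N.
  by rewrite (eq_pnat _ (pchar_poly F)) pnatX (pnatE _ p_pr) pcharF.
have rho_h : map_poly red h = map_poly red g ^+ (p ^ s).
  rewrite rho_g rmorphB /= map_polyXn map_polyC /= def_alpha rmorphXn.
  by rewrite exprDn_pchar 1?exprNn_pchar ?pchar_q // exprM rmorphXn.
have irr_phi : irreducible_poly (map_poly red g).
  apply: (irreducible_rho red_surj red_eq0 gamma_sq0 monic_g _ irr_g).
  by rewrite rho_g separable_Xn_sub_C.
have distC d : is_kappa gamma f C d -> (d < p ^ s)%N ->
    rt_distance C = (n * d + 1)%N.
  (* [n] also occurs in the type of [C], so the degree is substituted in the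
     value only. *)
  move=> kappaC lt_d; rewrite [RHS](_ : _ = d * (size g).-1 + 1)%N.
    exact: (rt_distance_kappa red_surj red_eq0 _ _ _ _ rho_h).
  by rewrite size_g mulnC.
split=> [C0|C1|tau lt_tau defC|omega t kappa G|omega t kappa mu G].
- rewrite /rt_distance C0; case: pickP => // c.
  by rewrite !inE andNb.
- rewrite (distC 0) ?muln0 // C1; exact: is_kappa_unit.
- apply: distC; rewrite // defC.
  exact: (is_kappa_gamma red_surj red_eq0 _ _ _ _ rho_h).
- case=> /andP[_ lt_omega] kappaC _ _ defC.
  apply: distC; rewrite ?defC //; apply: leq_ltn_trans lt_omega.
  exact: is_kappa_le kappaC.
- case=> /and3P[lt_mu le_kappa lt_omega] kappa3 _ _ defC.
  have lt_mu_q : (mu < p ^ s)%N.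
    exact: leq_ltn_trans (leq_trans (ltnW lt_mu) le_kappa) lt_omega.
  apply: distC => //; rewrite defC.
  exact: (is_kappa_join red_surj red_eq0 _ _ _ _ rho_h _ _ kappa3 (ltnW lt_mu)).
Qed.
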